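(* There is an absolute constant $b>0$ such that for every $k\ge1$ and every extended access graph $G$ whose underlying graph is a finite simple path labeled surjectively by exactly $k+1$ pages, $r_{\mathrm{MAXFAR}}(G,k)\le b\, r^\infty_{\mathsf{obl}}(G,k)$.
   Context: Paging with a cache of $k$ slots, initially empty; a fault occurs when a requested page is not in the cache, and it is brought in, evicting a page if the cache is full. $A(k,\sigma)$ is the number of faults and $\mathrm{OPT}(k,\sigma)$ the offline minimum. An extended access graph is a graph with vertices labeled by pages; its request sequences are label sequences of vertex walks in which consecutive vertices are equal or adjacent. $r_A(G,k)=\inf\{r: E[A(k,\sigma)]\le r\,\mathrm{OPT}(k,\sigma)\ \forall\sigma\}$ (strict ratio); $r^\infty_{\mathsf{obl}}(G,k)$ is the infimum over randomized online algorithms of the asymptotic ratio (same inequality with an additive constant $C\ge0$ allowed). Let $G=\langle v_1,\dots,v_m\rangle$ be a simple path with surjective labeling $\ell$ onto a set $\mathcal P$ of $k+1$ pages. For a vertex $v_i$, define $p\prec_i q$ if every path from $v_i$ to a vertex labeled $q$ contains a vertex labeled $p$; let $M_i$ be the set of $\prec_i$-maximal pages and $M_i'\subseteq M_i$ those pages appearing on both sides of $v_i$ in $G$. On $M_i'$ define the linear order $p\prec_i^L q$ if, walking from $v_i$ to the left, a vertex labeled $p$ is reached before one labeled $q$ (the analogous right order is its reverse). Phases: the request sequence is split into consecutive phases, each ending just before the request to its $(k+1)$-st distinct page (or at the end); a page is marked if requested in the current phase. Algorithm MAXFAR (which knows $G$ and the walk's vertices) is a marking algorithm (never evicts a marked page).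 If the current phase began at vertex $v_i$, on the $j$-th fault of the phase let $N_j\subseteq M_i$ be the set of unmarked $\prec_i$-maximal pages; evict a page of $N_j\cap M_i'$ in the middle of $N_j\cap M_i'$ with respect to $\prec_i^L$; if $N_j$ contains only pages appearing on one side of $v_i$, evict one of them. *)

(* Defs.v *)
From HB Require Import structures.
From mathcomp Require Import all_boot all_order all_algebra.
From mathcomp Require Import all_classical all_reals all_analysis.

Set Implicit Arguments.
Unset Strict Implicit.
Unset Printing Implicit Defensive.

Import Order.TTheory GRing.Theory Num.Theory.
Local Open Scope ring_scope.

(* A service is a list of pairs (requested page, page to evict); the second    *)
(* component is only used when the request is a fault on a full cache.         *)
Section Paging.
Variables (P : finType) (k : nat).
Implicit Types (C : {set P}) (s : seq (P * P)).

Definition serve C (pe : P * P) : {set P} :=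
  if pe.1 \in C then C
  else if (#|C| < k)%N then pe.1 |: C
  else pe.1 |: (C :\ pe.2).

Definition cache_after C s : {set P} := foldl serve C s.

Fixpoint nfaults C s : nat :=
  if s is pe :: s' then ((pe.1 \notin C) + nfaults (serve C pe) s')%N else 0%N.

Fixpoint valid_service C s : bool :=
  if s is pe :: s' then
    ((pe.1 \notin C) && (k <= #|C|)%N ==> (pe.2 \in C))
    && valid_service (serve C pe) s'
  else true.

(* The default value [size sigma] bounds every fault count, so it never        *)
(* lowers the minimum, which ranges over a nonempty set as soon as 0 < k.      *)
Definition OPT (sigma : seq P) : nat :=
  \big[minn/size sigma]_(ev : (size sigma).-tuple P
                         | valid_service finset.set0 (zip sigma ev))
    nfaults finset.set0 (zip sigma ev).

End Paging.

Record ext_access_graph (P : finType) := ExtAccessGraph {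
  vertex : finType;
  adj : rel vertex;
  adj_sym : symmetric adj;
  adj_irr : irreflexive adj;
  label : vertex -> P
}.

Definition path_adj (m : nat) : rel 'I_m :=
  fun i j => (i.+1 == j :> nat) || (j.+1 == i :> nat).

Lemma path_adj_sym m : symmetric (@path_adj m).
Proof. by move=> i j; rewrite /path_adj orbC. Qed.

Lemma path_adj_irr m : irreflexive (@path_adj m).
Proof. by move=> i; rewrite /path_adj orbb gtn_eqF. Qed.

Definition path_graph (P : finType) (m : nat) (lab : 'I_m -> P) :=
  ExtAccessGraph (@path_adj_sym m) (@path_adj_irr m) lab.

Section Algorithms.
Variables (P : finType) (G : ext_access_graph P) (k : nat).
Implicit Types (w : seq (vertex G)).

Definition is_walk w : bool := sorted (fun u v => (u == v) || adj u v) w.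

Definition requests w : seq P := map (@label P G) w.

(* A deterministic online algorithm maps the walk up to and including the      *)
(* current vertex to the page evicted at that vertex, should this be needed.   *)
(* No explicit state is required: the past walk determines the cache.          *)
Definition online_alg := seq (vertex G) -> P.

Definition service (A : online_alg) w : seq (P * P) :=
  zip (requests w) [seq A (take i.+1 w) | i <- iota 0 (size w)].

Definition valid_alg (A : online_alg) : Prop :=
  forall w, is_walk w -> valid_service k finset.set0 (service A w).

Definition alg_cache (A : online_alg) w : {set P} :=
  cache_after k finset.set0 (service A w).

Definition alg_faults (A : online_alg) w : nat :=
  nfaults k finset.set0 (service A w).

(* A randomized online algorithm is a random deterministic one. *)
Record rand_alg (R : realType) := RandAlg {
  rand_disp : measure_display;
  rand_space : measurableType rand_disp;
  rand_prob : probability rand_space R;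
  rand_run : rand_space -> online_alg;
  rand_valid : forall omega, valid_alg (rand_run omega);
  rand_meas : forall w p,
    measurable ([set omega | rand_run omega w = p]%classic : set rand_space)
}.

Definition rand_faults (R : realType) (A : rand_alg R) w : \bar R :=
  ('E_(rand_prob A) [fun omega => (alg_faults (@rand_run R A omega) w)%:R])%E.

(* The ratios are attached to the function giving the (expected) number of     *)
(* faults on each walk; the infimum of the empty set is +oo.                   *)
Definition strict_ratio (R : realType) (cost : seq (vertex G) -> \bar R)
    : \bar R :=
  ereal_inf [set r%:E | r in [set r : R | forall w, is_walk w ->
    (cost w <= (r * (OPT k (requests w))%:R)%:E)%E]]%classic.

Definition asymptotic_ratio (R : realType) (cost : seq (vertex G) -> \bar R)
    : \bar R :=
  ereal_inf [set r%:E | r in [set r : R | exists C : R, 0 <= C /\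
    forall w, is_walk w ->
    (cost w <= (r * (OPT k (requests w))%:R + C)%:E)%E]]%classic.

Definition r_det (R : realType) (A : online_alg) : \bar R :=
  strict_ratio (fun w => ((alg_faults A w)%:R : R)%:E).

Definition r_obl_infty (R : realType) : \bar R :=
  ereal_inf [set x : \bar R | exists A : rand_alg R,
                                x = asymptotic_ratio (rand_faults A)]%classic.

Definition phase_step (s : seq (vertex G)) (v : vertex G) : seq (vertex G) :=
  if (k < size (undup (requests (rcons s v))))%N then [:: v] else rcons s v.

Definition current_phase w : seq (vertex G) := foldl phase_step [::] w.

Definition prec (v : vertex G) (p q : P) : Prop :=
  forall s, path (@adj P G) v s -> uniq (v :: s) -> label (last v s) = q ->
  exists2 u, u \in v :: s & label u = p.

Definition prec_max (v : vertex G) : {set P} :=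
  [set p | `[< forall q, prec v p q -> q = p >]]%SET.

End Algorithms.

Section Maxfar.
Variables (P : finType) (m k : nat) (lab : 'I_m -> P).
Local Notation G := (path_graph lab).

Definition prec_max_two_sided (i : 'I_m) : {set P} :=
  [set p in @prec_max P G i |
    [exists j : 'I_m, (j < i)%N && (lab j == p)] &&
    [exists j : 'I_m, (i < j)%N && (lab j == p)]]%SET.

Definition left_before (i : 'I_m) (p q : P) : bool :=
  [exists j : 'I_m, [&& (j <= i)%N, lab j == p &
    [forall j' : 'I_m, (j <= j' <= i)%N ==> (lab j' != q)]]].

(* Both medians of a set of even cardinality are in the middle. *)
Definition in_middle (i : 'I_m) (S : {set P}) (e : P) : bool :=
  let before := #|[set q in S | left_before i q e]%SET| in
  let after := #|[set q in S | left_before i e q]%SET| in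
  [&& e \in S, (before <= after.+1)%N & (after <= before.+1)%N].

Definition maxfar_choice (i : 'I_m) (N : {set P}) (e : P) : bool :=
  let S := (N :&: prec_max_two_sided i)%SET in
  if S == finset.set0 then e \in N else in_middle i S e.

(* The choices left open by the rule (which median, which one-sided page) are  *)
(* arbitrary: [A] is MAXFAR for some way of making them.                       *)
Definition is_maxfar (A : online_alg G) : Prop :=
  valid_alg k A /\
  forall (w : seq 'I_m) (x : 'I_m), is_walk (rcons w x : seq (vertex G)) ->
    lab x \notin alg_cache k A w -> (k <= #|alg_cache k A w|)%N ->
    let phase : seq 'I_m := @current_phase P G k (rcons w x) in
    let i := head x phase in
    let N := [set p in @prec_max P G i | p \notin [seq lab v | v <- phase]]%SET in
    maxfar_choice i N (A (rcons w x)).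

End Maxfar.

(* Main.v *)
Require Import Defs.
From mathcomp Require Import all_classical all_reals all_analysis measurable_realfun.
From mathcomp Require Import all_boot all_order all_algebra zify lra.

Set Implicit Arguments.
Unset Strict Implicit.
Unset Printing Implicit Defensive.

Import Order.TTheory GRing.Theory Num.Theory.

(* With k + 1 pages, a full cache misses exactly one page, its hole. Let n be the *)
(* largest number of two-sided maximal pages at a vertex.                         *)
(* - MAXFAR keeps its hole on an unmarked maximal page. When a two-sided hole is  *)
(*   requested, all maximal pages on one side of it in the left order have been   *)
(*   visited, so the number of unmarked ones is halved; at most two maximal pages *)
(*   are one-sided. Hence a phase costs at most log2 n + 4 faults, while OPT pays *)
(*   at least one per phase.                                                      *)
(* - Conversely, at a vertex with n two-sided maximal pages an adversary runs a   *)
(*   binary search: it tours around the vertex, avoiding one half of the remaining*)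
(*   candidates. The two possible tours jointly request all pages, so one of them *)
(*   costs any randomized algorithm 1/2 in expectation. A round of log2 n tours   *)
(*   avoids a single page altogether and so costs OPT at most one fault. Thus     *)
(*   every asymptotic ratio is at least (log2 n) / 2; it is also at least 1       *)
(*   because OPT is unbounded, and log2 n + 4 <= 6 max(1, (log2 n) / 2).          *)

Section FiniteSets.
Variable T : finType.
Implicit Types S : {set T}.

Lemma exists_notin S : #|S| < #|T| -> exists x, x \notin S.
Proof.
move=> S_small; have /card_gt0P[x] : 0 < #|~: S| by have := cardsC S; lia.
by rewrite inE; exists x.
Qed.

Lemma exists_separated_halves (f : T -> nat) S n :
  {in S &, injective f} -> n.*2 <= #|S| ->
  exists S1 S2 : {set T}, [/\ S1 \subset S /\ S2 \subset S, n <= #|S1|, n <= #|S2| &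
    {in S1 & S2, forall x y, f x < f y}].
Proof.
move=> f_inj nS; pose s := sort (relpre f leq) (enum S).
have s_enum : perm_eq s (enum S) by rewrite perm_sort.
have s_uniq : uniq s by rewrite (perm_uniq s_enum) enum_uniq.
have s_mem x : (x \in s) = (x \in S) by rewrite (perm_mem s_enum) mem_enum.
have s_size : size s = #|S| by rewrite size_sort -cardE.
have s_sorted : pairwise (relpre f leq) s.
  rewrite -sorted_pairwise; last by move=> y x z; apply: leq_trans.
  by apply: sort_sorted => x y; apply: leq_total.
move: s_uniq s_sorted; rewrite -(cat_take_drop n s) cat_uniq pairwise_cat.
move=> /and3P[take_uniq /hasPn disj drop_uniq] /and3P[/allrelP le_f _ _].
exists [set:: take n s], [set:: drop n s].
split=> [|||x y].
- by split; apply/subsetP => x; rewrite inE -s_mem; [apply: mem_take|apply: mem_drop].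
- by rewrite cardsE (card_uniqP take_uniq) size_takel //; lia.
- by rewrite cardsE (card_uniqP drop_uniq) size_drop; lia.
rewrite !inE => xs ys; rewrite ltn_neqAle (le_f x y xs ys : f x <= f y) andbT.
apply: contraNneq (disj y ys) => /f_inj <- //.
- by rewrite -s_mem (mem_take xs).
- by rewrite -s_mem (mem_drop ys).
Qed.

End FiniteSets.

Section Services.
Variables (P : finType) (k : nat).
Implicit Types (C : {set P}) (p q : P) (pe : P * P).
Implicit Types (s : seq (P * P)) (sigma tau : seq P).

Lemma nfaults_cat C s1 s2 :
  nfaults k C (s1 ++ s2) = nfaults k C s1 + nfaults k (cache_after k C s1) s2.
Proof. by elim: s1 C => //= pe s1 IH C; rewrite IH addnA. Qed.

Lemma valid_service_cat C s1 s2 :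
  valid_service k C (s1 ++ s2) =
  valid_service k C s1 && valid_service k (cache_after k C s1) s2.
Proof. by elim: s1 C => //= pe s1 IH C; rewrite IH andbA. Qed.

Lemma cache_after_cat C s1 s2 :
  cache_after k C (s1 ++ s2) = cache_after k (cache_after k C s1) s2.
Proof. exact: foldl_cat. Qed.

Lemma nfaults_rcons C s pe :
  nfaults k C (rcons s pe) = nfaults k C s + (pe.1 \notin cache_after k C s).
Proof. by rewrite -cats1 nfaults_cat /= addn0. Qed.

Lemma cache_after_rcons C s pe :
  cache_after k C (rcons s pe) = serve k (cache_after k C s) pe.
Proof. by rewrite -cats1 cache_after_cat. Qed.

Lemma nfaults_le_size C s : nfaults k C s <= size s.
Proof. by elim: s C => //= pe s IH C; rewrite -add1n leq_add ?leq_b1. Qed.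

Lemma serve_hit C pe : pe.1 \in C -> serve k C pe = C.
Proof. by rewrite /serve => ->. Qed.

Lemma serve_load C pe : pe.1 \notin C -> #|C| < k -> serve k C pe = pe.1 |: C.
Proof. by rewrite /serve => /negbTE -> ->. Qed.

Lemma serve_evict C pe :
  pe.1 \notin C -> k <= #|C| -> serve k C pe = pe.1 |: (C :\ pe.2).
Proof. by rewrite /serve ltnNge => /negbTE -> ->. Qed.

Lemma mem_serve C pe : pe.1 \in serve k C pe.
Proof. by rewrite /serve; do 2?case: ifP => //; rewrite setU11. Qed.

Lemma serve_subset C pe : serve k C pe \subset pe.1 |: C.
Proof.
by rewrite /serve; do 2?case: ifP => _; rewrite ?subsetUr // setUS ?subsetDl.
Qed.

Lemma card_serve C pe : #|C| <= k ->
  (pe.1 \notin C) && (k <= #|C|) ==> (pe.2 \in C) -> #|serve k C pe| <= k.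
Proof.
have [pC|pC] := boolP (pe.1 \in C); first by rewrite serve_hit.
case: (ltnP #|C| k) => Ck /= le_Ck eC; first by rewrite serve_load // cardsU1 pC.
rewrite serve_evict // cardsU1 !inE (negbTE pC) andbF.
by move: le_Ck; rewrite (cardsD1 pe.2) eC.
Qed.

Lemma card_cache_after C s :
  valid_service k C s -> #|C| <= k -> #|cache_after k C s| <= k.
Proof.
elim: s C => //= pe s IH C /andP[e_ok vs] Ck.
by apply: IH vs _; apply: card_serve.
Qed.

Lemma nfaults_gt0 C s p : p \notin C -> p \in unzip1 s -> 0 < nfaults k C s.
Proof.
elim: s C => //= pe s IH C pC; rewrite inE => /predU1P[<-|ps]; first by rewrite pC.
by have [peC|//] := boolP (pe.1 \in C); rewrite serve_hit ?IH.
Qed.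

Lemma exists_valid_service C sigma : 0 < k ->
  exists2 s, unzip1 s = sigma & valid_service k C s.
Proof.
move=> k_gt0; elim: sigma C => [|p sigma IH] C; first by exists [::].
have [e e_ok] : exists e, (p \notin C) && (k <= #|C|) ==> (e \in C).
  have [->|[e eC]] := set_0Vmem C; last by exists e; rewrite eC implybT.
  by exists p; rewrite cards0 leqNgt k_gt0 andbF.
have [s <- vs] := IH (serve k C (p, e)).
by exists ((p, e) :: s) => //=; rewrite e_ok.
Qed.

Lemma OPT_le_nfaults s :
  valid_service k set0 s -> OPT k (unzip1 s) <= nfaults k set0 s.
Proof.
move=> vs; have sz : size (unzip2 s) == size (unzip1 s) by rewrite !size_map.
rewrite /OPT -minEnat -leEnat.
by apply: (bigmin_inf (Tuple sz)); rewrite /= zip_unzip.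
Qed.

Lemma OPT_ge n sigma : 0 < k ->
  (forall s, unzip1 s = sigma -> valid_service k set0 s -> n <= nfaults k set0 s) ->
  n <= OPT k sigma.
Proof.
move=> k_gt0 n_le; rewrite /OPT; elim/big_ind: _ => [|x y nx ny|ev vev].
- have [s es vs] := exists_valid_service set0 sigma k_gt0.
  by apply: leq_trans (n_le s es vs) _; rewrite -es size_map nfaults_le_size.
- by rewrite leq_min nx.
- by apply: n_le => //; rewrite unzip1_zip // size_tuple.
Qed.

Lemma OPT_lt_cat_cover sigma tau : 0 < k -> k < #|P| -> (forall p, p \in tau) ->
  OPT k sigma < OPT k (sigma ++ tau).
Proof.
move=> k_gt0 kP tau_full; apply: OPT_ge => // s es vs; pose n := size sigma.
have e1 : unzip1 (take n s) = sigma.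
  by rewrite /unzip1 map_take -/(unzip1 _) es take_size_cat.
have e2 : unzip1 (drop n s) = tau.
  by rewrite /unzip1 map_drop -/(unzip1 _) es drop_size_cat.
move: vs; rewrite -(cat_take_drop n s) valid_service_cat nfaults_cat => /andP[vs1 _].
rewrite -addn1 leq_add //; first by rewrite -e1 OPT_le_nfaults.
have [|p pC] := @exists_notin _ (cache_after k set0 (take n s)).
  by apply: leq_ltn_trans kP; rewrite card_cache_after ?cards0.
by apply: (nfaults_gt0 pC); rewrite e2.
Qed.

Lemma service_all_hits C s : {subset unzip1 s <= C} ->
  [/\ valid_service k C s, cache_after k C s = C & nfaults k C s = 0].
Proof.
elim: s => //= pe s IH sC; have pC : pe.1 \in C by apply: sC; rewrite mem_head.
have [|vs cs fs] := IH; first by move=> p ps; apply: sC; rewrite inE ps orbT.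
by rewrite serve_hit // pC.
Qed.

Lemma service_no_eviction C s : #|C :|: [set:: unzip1 s]| <= k ->
  [/\ valid_service k C s, cache_after k C s = C :|: [set:: unzip1 s] &
      nfaults k C s + #|C| = #|C :|: [set:: unzip1 s]|].
Proof.
elim: s C => [|pe s IH] C /=; first by rewrite set_nil setU0.
rewrite set_cons setUCA setUA => Uk; have [vs cs fs] := IH _ Uk.
have Ck : pe.1 \notin C -> #|C| < k.
  move=> pC; apply: leq_trans Uk; apply: leq_trans (subset_leq_card (subsetUl _ _)).
  by rewrite cardsU1 pC.
have -> : serve k C pe = pe.1 |: C.
  have [pC|pC] := boolP (pe.1 \in C); last by rewrite serve_load ?Ck.
  by rewrite serve_hit // (setUidPr _) ?sub1set.
rewrite vs andbT; split=> //; last by rewrite -fs cardsU1; lia.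
by apply/implyP => /andP[/Ck]; rewrite ltnNge => /negbTE ->.
Qed.

Definition servable sigma C n := exists s,
  [/\ unzip1 s = sigma, valid_service k set0 s, cache_after k set0 s = C &
      nfaults k set0 s <= n].

Lemma servable_OPT sigma C n : servable sigma C n -> OPT k sigma <= n.
Proof. by move=> [s [<- vs _]]; apply: leq_trans (OPT_le_nfaults vs). Qed.

Hypothesis P_card : #|P| = k.+1.

Lemma card_setC1_cache q : #|[set~ q]| = k.
Proof. by rewrite cardsC1 P_card. Qed.

Lemma serve_hole q q' : q != q' -> serve k [set~ q] (q, q') = [set~ q'].
Proof.
move=> qq'; rewrite serve_evict ?card_setC1_cache //= ?inE ?eqxx //.
by apply/setP => x; rewrite !inE; have [->|_] /= := eqVneq x q; rewrite ?andbT.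
Qed.

Lemma full_cache_hole C p : p \notin C -> k <= #|C| -> C = [set~ p].
Proof.
move=> pC Ck; apply/eqP; rewrite eqEcard card_setC1_cache Ck andbT.
by apply/subsetP => q qC; rewrite in_setC1; apply: contraNneq pC => <-.
Qed.

Lemma servable_missing sigma q : sigma =i predC1 q -> servable sigma [set~ q] k.
Proof.
move=> sigmaE; pose s := [seq (p, q) | p <- sigma].
have s_unzip : unzip1 s = sigma by rewrite /unzip1 mapK.
have pages : set0 :|: [set:: unzip1 s] = [set~ q].
  by rewrite set0U s_unzip; apply/setP => p; rewrite !inE sigmaE.
have := @service_no_eviction set0 s; rewrite pages card_setC1_cache cards0 addn0.
by move=> /(_ (leqnn k))[vs cs fs]; exists s; rewrite fs.
Qed.

Lemma service_move_hole sigma q q' :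
  q != q' -> q' \notin sigma -> q \in sigma ->
  let s := [seq (p, q') | p <- sigma] in
  [/\ valid_service k [set~ q] s, cache_after k [set~ q] s = [set~ q'] &
      nfaults k [set~ q] s = 1].
Proof.
move=> qq'; elim: sigma => //= p sigma IH; rewrite !in_cons negb_or => /andP[q'p q'sigma].
have [<- _|qp /= q_sigma] := eqVneq q p; last first.
  have pq : p \in [set~ q] by rewrite in_setC1 eq_sym.
  by have [||vs cs fs] := IH; rewrite // serve_hit //= pq vs cs fs.
have [|vs cs fs] := @service_all_hits [set~ q'] [seq (r, q') | r <- sigma].
  by move=> r; rewrite /unzip1 mapK // in_setC1; apply: contraTneq => ->.
by rewrite serve_hole // !inE eqxx eq_sym qq' implybT vs cs fs.
Qed.

Lemma servable_cat_missing sigma tau q q' n :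
  servable sigma [set~ q] n -> tau =i predC1 q' ->
  servable (sigma ++ tau) [set~ q'] n.+1.
Proof.
move=> [s [es vs cs fs]] tauE; pose t := [seq (p, q') | p <- tau].
have et : unzip1 t = tau by rewrite /unzip1 mapK.
have [vt ct ft] : [/\ valid_service k [set~ q] t,
    cache_after k [set~ q] t = [set~ q'] & nfaults k [set~ q] t <= 1].
  have [->|qq'] := eqVneq q q'.
    have [|-> -> -> //] := @service_all_hits [set~ q'] t.
    by move=> p; rewrite et tauE !inE.
  by have [||-> -> ->] := @service_move_hole tau q q' qq'; rewrite ?tauE ?inE ?eqxx.
exists (s ++ t); rewrite valid_service_cat cache_after_cat nfaults_cat vs cs vt ct.
by split=> //; [rewrite /unzip1 map_cat -/(unzip1 s) es -/(unzip1 t) et | lia].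
Qed.

End Services.

Section OnlineServices.
Variables (P : finType) (G : ext_access_graph P) (k : nat) (A : online_alg G).
Implicit Types (w u : seq (vertex G)) (x : vertex G).

Lemma service_rcons w x :
  service A (rcons w x) = rcons (service A w) (label x, A (rcons w x)).
Proof.
rewrite /service /requests map_rcons size_rcons -addn1 iotaD map_cat /= add0n cats1.
rewrite zip_rcons ?size_map ?size_iota // -(size_rcons w x) take_size.
congr (rcons (zip _ _) _); apply/eq_in_map => i; rewrite mem_iota add0n => /= iw.
by rewrite -cats1 takel_cat.
Qed.

Lemma service_cat w u :
  exists2 s, service A (w ++ u) = service A w ++ s & unzip1 s = requests u.
Proof.
elim/last_ind: u => [|u x [s es us]]; first by exists [::]; rewrite ?cats0.
exists (rcons s (label x, A (rcons (w ++ u) x))).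
  by rewrite -rcons_cat service_rcons es rcons_cat.
by rewrite /unzip1 map_rcons -/(unzip1 _) us /requests map_rcons.
Qed.

Lemma unzip1_service w : unzip1 (service A w) = requests w.
Proof. by have [s] := service_cat [::] w; rewrite cat0s => ->. Qed.

Lemma alg_faults_rcons w x : alg_faults k A (rcons w x) =
  alg_faults k A w + (label x \notin alg_cache k A w).
Proof. by rewrite /alg_faults service_rcons nfaults_rcons. Qed.

Lemma alg_cache_rcons w x :
  alg_cache k A (rcons w x) = serve k (alg_cache k A w) (label x, A (rcons w x)).
Proof. by rewrite /alg_cache service_rcons cache_after_rcons. Qed.

Lemma alg_faults_le_size w : alg_faults k A w <= size w.
Proof.
have := nfaults_le_size k set0 (service A w).
by rewrite -(size_map fst) -/(unzip1 _) unzip1_service size_map.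
Qed.

Lemma leq_alg_faults_cat w u : alg_faults k A w <= alg_faults k A (w ++ u).
Proof.
by have [s es _] := service_cat w u; rewrite /alg_faults es nfaults_cat leq_addr.
Qed.

Lemma OPT_le_alg_faults w : valid_alg k A -> is_walk w ->
  OPT k (requests w) <= alg_faults k A w.
Proof. by move=> vA ww; rewrite -unzip1_service OPT_le_nfaults ?vA. Qed.

Lemma alg_faults_covering_pair w u1 u2 : k < #|P| -> valid_alg k A -> is_walk w ->
  (forall p, (p \in requests u1) || (p \in requests u2)) ->
  (alg_faults k A w).*2 < alg_faults k A (w ++ u1) + alg_faults k A (w ++ u2).
Proof.
move=> kP vA ww cov.
have [|p pC] := @exists_notin _ (alg_cache k A w).
  by apply: leq_ltn_trans kP; rewrite card_cache_after ?cards0 ?vA.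
have [s1 e1 r1] := service_cat w u1; have [s2 e2 r2] := service_cat w u2.
rewrite /alg_faults e1 e2 !nfaults_cat -addnn.
case/orP: (cov p); rewrite -?r1 -?r2 => pr;
  have := nfaults_gt0 k pC pr; rewrite /alg_cache; lia.
Qed.

End OnlineServices.

Section ClosedWalks.
Variables (P : finType) (G : ext_access_graph P).
Implicit Types (v x y : vertex G) (w u : seq (vertex G)).

Definition closed_walk v u : bool := is_walk (v :: u) && (last v u == v).

Lemma closed_walk_is_walk v u : closed_walk v u -> is_walk (v :: u).
Proof. by case/andP. Qed.

Lemma is_walk_catl w u : is_walk (w ++ u) -> is_walk w.
Proof. by case/cat_sorted2. Qed.

Lemma is_walk_catr w u : is_walk (w ++ u) -> is_walk u.
Proof. by case/cat_sorted2. Qed.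

Lemma closed_walk_cat v u1 u2 :
  closed_walk v u1 -> closed_walk v u2 -> closed_walk v (u1 ++ u2).
Proof.
rewrite /closed_walk /= cat_path last_cat => /andP[w1 /eqP ->] /andP[w2 l2].
by rewrite w1 w2.
Qed.

Lemma closed_walk_step v y u :
  adj v y -> closed_walk y u -> closed_walk v (y :: rcons u v).
Proof.
rewrite /closed_walk /= rcons_path last_rcons eqxx => vy /andP[-> /eqP ->].
by rewrite [adj y v]adj_sym vy !orbT.
Qed.

Lemma closed_walk_covering v (D : {set vertex G}) :
  (forall x, x \in D -> exists u, [/\ closed_walk v u, x \in u & {subset u <= D}]) ->
  exists2 u, closed_walk v u & u =i D.
Proof.
move=> cov.
have [u [wu uD Du]] : exists u,
    [/\ closed_walk v u, {subset u <= D} & {subset enum D <= u}].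
  have : {subset enum D <= D} by move=> x; rewrite mem_enum.
  elim: (enum D) => [|x s IH] sD; first by exists [::]; rewrite /closed_walk /= eqxx.
  have [u1 [w1 xu1 u1D]] := cov x (sD x (mem_head _ _)).
  have [|u2 [w2 u2D su2]] := IH; first by move=> y ys; rewrite sD // inE ys orbT.
  exists (u1 ++ u2); split; first exact: closed_walk_cat.
  - by move=> y; rewrite mem_cat => /orP[/u1D|/u2D].
  - by move=> y; rewrite inE mem_cat => /predU1P[->|/su2 ->]; rewrite ?xu1 ?orbT.
by exists u => // x; apply/idP/idP => [/uD //|xD]; apply: Du; rewrite mem_enum.
Qed.

End ClosedWalks.

Section PathGeometry.
Variables (P : finType) (m : nat) (lab : 'I_m -> P).
Local Notation G := (path_graph lab).
Local Notation two_sided := (prec_max_two_sided lab).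
Implicit Types (i j x y z : vertex G) (s u : seq (vertex G)) (p q : P) (S : {set P}).

Definition between i j x : bool := minn i j <= x <= maxn i j.

Lemma walk_visits_between i x s :
  is_walk (i :: s) -> between i (last i s) x -> x \in i :: s.
Proof.
elim: s i => [|y s IH] i /=.
  by move=> _ bx; rewrite inE; apply/eqP/val_inj; move: bx; rewrite /between /=; lia.
move=> /andP[iy /IH xs] b; rewrite inE; case: eqP => //= xi.
apply: xs; move: b iy; have : (x : nat) <> i by move=> /val_inj.
by rewrite /between /path_adj -val_eqE /=; lia.
Qed.

Lemma exists_detour i j : exists u,
  [/\ closed_walk i u, j \in u & {in u, forall x, between i j x}].
Proof.
have [n] := ubnP ((i - j) + (j - i)); elim: n i => // n IH i dist_le.
have [<-|nij] := eqVneq i j.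
  exists [:: i]; rewrite /closed_walk /= !eqxx; split=> //; first exact: mem_head.
  by move=> x; rewrite inE => /eqP ->; rewrite /between; lia.
have [y [iy bj y_lt]] : exists y,
    [/\ path_adj i y, between i j y & (y - j) + (j - y) < n].
  have nij' : (i : nat) != j by rewrite val_eqE.
  have [ij|ji] := ltnP i j.
    have yP : i.+1 < m by apply: leq_ltn_trans (ltn_ord j).
    by exists (Ordinal yP); rewrite /path_adj /between /=; split; lia.
  have yP : i.-1 < m by apply: leq_ltn_trans (ltn_ord i); lia.
  by exists (Ordinal yP); rewrite /path_adj /between /=; split; lia.
have [u [wu ju bu]] := IH y y_lt; exists (y :: rcons u i); split.
- exact: closed_walk_step.
- by rewrite inE mem_rcons inE ju !orbT.
move=> x; rewrite inE mem_rcons inE.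
by case/or3P => [/eqP ->|/eqP ->|/bu] //; move: bj; rewrite /between; lia.
Qed.

Lemma first_hit i j (Q : pred (vertex G)) : Q j -> exists x,
  [/\ between i j x, Q x & forall y, between i x y -> Q y -> y = x].
Proof.
move=> Qj; pose hit x := between i j x && Q x.
have hit_j : hit j by rewrite /hit Qj /between; lia.
have [x /andP[bx Qx] x_min] := arg_minnP (fun x => (x - i) + (i - x)) hit_j.
exists x; split=> // y byx Qy; apply/val_inj => /=.
by have := x_min y; rewrite /hit Qy andbT; move: bx byx; rewrite /between; lia.
Qed.

Lemma prec_max_between i p q : p \in prec_max i ->
  (forall j, lab j = q -> exists2 x, between i j x & lab x = p) -> q = p.
Proof.
rewrite inE => /asboolP pM behind; apply: pM => s ws _ /behind[x bx lx].
exists x => //; apply: walk_visits_between bx.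
by apply: sub_path ws => y z /= ->; apply: orbT.
Qed.

Definition reachable i S : {set vertex G} :=
  [set j | [forall x, between i j x ==> (lab x \notin S)]].

Definition reachable_pages i S : {set P} := [set lab j | j in reachable i S].

Lemma reachableP i S j :
  reflect (forall x, between i j x -> lab x \notin S) (j \in reachable i S).
Proof. by rewrite in_set; apply: 'forall_implyP. Qed.

Lemma notin_reachable_pages i S q j : q \notin reachable_pages i S -> lab j = q ->
  exists2 x, between i j x & lab x \in S.
Proof.
move=> q_nr lj; have : j \notin reachable i S.
  by apply: contra q_nr => j_r; apply/imsetP; exists j.
rewrite in_set negb_forall => /existsP[x]; rewrite negb_imply negbK => /andP[bx xS].
by exists x.
Qed.

Lemma nearest_in_set i j S : lab j \in S -> exists x,
  [/\ between i j x, lab x \in S &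
      forall y, lab y \notin reachable_pages i S -> between i x y -> y = x].
Proof.
move=> jS; have [x [bx xS x_first]] := @first_hit i j (fun z => lab z \in S) jS.
exists x; split=> // y y_nr bxy; have [z byz zS] := notin_reachable_pages y_nr erefl.
have zx : z = x by apply: x_first zS; move: bxy byz; rewrite /between; lia.
by apply/val_inj; move: bxy byz; rewrite zx /between /=; lia.
Qed.

Lemma exists_tour i S : exists2 u, closed_walk i u & requests u =i reachable_pages i S.
Proof.
have [j /reachableP j_r|u wu u_r] := @closed_walk_covering P G i (reachable i S).
  have [u [wu ju bu]] := exists_detour i j; exists u; split=> // x /bu bx.
  apply/reachableP => y bxy; apply: j_r.
  by move: bx bxy; rewrite /between; lia.
exists u => // p.
by apply/mapP/imsetP => -[j j_in ->]; exists j; rewrite // ?u_r // -u_r.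
Qed.

Lemma reachable_pages_notin i S q : q \in reachable_pages i S -> q \notin S.
Proof.
move=> /imsetP[j /reachableP j_r ->]; apply: j_r.
by rewrite /between; lia.
Qed.

Lemma reachable_pages0 i :
  (forall p, exists v, lab v = p) -> reachable_pages i set0 = setT.
Proof.
move=> lab_surj; apply/setP => p; rewrite inE; apply/negPn/negP => p_nr.
by have [j lj] := lab_surj p; have [x _] := notin_reachable_pages p_nr lj; rewrite inE.
Qed.

Lemma reachable_pages_prec_max i p :
  p \in prec_max i -> reachable_pages i [set p] = [set~ p].
Proof.
move=> pM; apply/setP => q; apply/idP/idP => [/reachable_pages_notin|].
  by rewrite !inE.
rewrite in_setC1; apply: contraNT => q_nr; apply/eqP/(prec_max_between pM) => j lj.
by have [x bx /set1P lx] := notin_reachable_pages q_nr lj; exists x.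
Qed.

Lemma exists_tour_missing i p : p \in prec_max i ->
  exists2 u, closed_walk i u & requests u =i predC1 p.
Proof.
move=> pM; have [u wu uE] := exists_tour i [set p]; exists u => // q.
by rewrite uE reachable_pages_prec_max // !inE.
Qed.

(* Shifted by one, so that 0 means that p does not occur at i or to its left. *)
Definition left_pos i p : nat := \max_(j : vertex G | (j <= i) && (lab j == p)) j.+1.

Lemma leq_left_pos i x : x <= i -> x < left_pos i (lab x).
Proof. by move=> xi; apply: (@leq_bigmax_cond _ _ _ x); rewrite xi eqxx. Qed.

Lemma left_pos_attained i p : 0 < left_pos i p ->
  exists j, [/\ j <= i, lab j = p & left_pos i p = j.+1].
Proof.
rewrite /left_pos; elim/big_ind: _ => // [a b Ha Hb|j /andP[ji /eqP lj] _].
  by case: (leqP a b).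
by exists j.
Qed.

Lemma left_pos_inj i p q : 0 < left_pos i p -> left_pos i p = left_pos i q -> p = q.
Proof.
move=> p_gt0 epq; have [j [_ lj ej]] := left_pos_attained p_gt0.
have [|j' [_ lj' ej']] := @left_pos_attained i q; first by rewrite -epq.
by rewrite -lj -lj'; congr lab; apply/val_inj; move: epq; rewrite ej ej' => -[].
Qed.

Lemma left_beforeE i p q : left_before lab i p q = (left_pos i q < left_pos i p).
Proof.
apply/existsP/idP => [[j /and3P[ji /eqP <- /forallP j_last]]|lt_qp].
  apply: leq_trans (leq_left_pos ji); rewrite ltnS.
  apply/bigmax_leqP => x /andP[xi /eqP lx]; rewrite ltnNge; apply/negP => jx.
  by have := j_last x; rewrite jx xi lx eqxx.
have [j [ji lj ej]] := left_pos_attained (leq_ltn_trans (leq0n _) lt_qp).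
exists j; rewrite ji lj eqxx; apply/forallP => x; apply/implyP => /andP[jx xi].
apply: contraTneq lt_qp => <-; rewrite -leqNgt ej.
exact: leq_trans (leq_left_pos xi).
Qed.

Lemma two_sidedP i p : p \in two_sided i ->
  [/\ p \in prec_max i, exists2 j : vertex G, j < i & lab j = p &
      exists2 j : vertex G, i < j & lab j = p].
Proof.
rewrite in_set => /and3P[pM /existsP[j /andP[ji /eqP lj]]].
by case/existsP => j' /andP[ji' /eqP lj']; split=> //; [exists j | exists j'].
Qed.

Lemma two_sided_subset i : two_sided i \subset prec_max i.
Proof. by apply/subsetP => p /two_sidedP[]. Qed.

Lemma two_sided_left_pos_gt0 i p : p \in two_sided i -> 0 < left_pos i p.
Proof.
case/two_sidedP => _ [j ji <-] _; apply: leq_trans (leq_left_pos (ltnW ji)).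
exact: ltn0Sn.
Qed.

Lemma two_sided_left_pos_inj i : {in two_sided i &, injective (left_pos i)}.
Proof. by move=> p q /two_sided_left_pos_gt0 p_gt0 _; apply: left_pos_inj. Qed.

Lemma visited_left_or_right i s (p := lab (last i s)) :
  is_walk (i :: s) -> p \in prec_max i ->
  (forall q, left_before lab i q p -> q \in requests (i :: s)) \/
  (forall q, left_before lab i p q -> q \in requests (i :: s)).
Proof.
move=> ws pM; have visited x : between i (last i s) x -> lab x \in requests (i :: s).
  by move=> bx; apply: map_f; apply: walk_visits_between.
have [le_last|lt_last] := leqP (last i s) i; [left|right] => q.
  rewrite left_beforeE => lt_q; have p_le := leq_left_pos le_last.
  have [j [ji lj ej]] := left_pos_attained (leq_ltn_trans (leq0n _) lt_q).
  by rewrite -lj; apply: visited; move: lt_q p_le; rewrite -/p ej /between; lia.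
(* Were q not visited, it would lie behind the page p on both sides of i. *)
rewrite left_beforeE => lt_q; apply/negPn/negP => q_nv.
suff eq_qp : q = p by rewrite eq_qp ltnn in lt_q.
apply: (prec_max_between pM) => j lj; have [ij|ji] := leqP i j.
  exists (last i s) => //; have [/visited|] := boolP (between i (last i s) j).
    by rewrite lj (negbTE q_nv).
  by rewrite /between; lia.
have [y [yi ly ey]] := left_pos_attained (leq_ltn_trans (leq0n _) lt_q).
have := leq_left_pos (ltnW ji); rewrite lj => q_ge.
by exists y => //; move: lt_q q_ge; rewrite ey /between; lia.
Qed.

Lemma prec_max_label_neq i p : 1 < #|P| -> p \in prec_max i -> lab i != p.
Proof.
move=> P_gt1 pM; apply/eqP => ip.
have [q /set1P] : exists q, q \notin [set p] by apply: exists_notin; rewrite cards1.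
by apply; apply: (prec_max_between pM) => j _; exists i => //; rewrite /between; lia.
Qed.

(* A page missing on both sides would lie behind the page of S1 nearest to the   *)
(* right of i: on the left, that page is closer to i than all pages of S2.       *)
Lemma reachable_pages_separated i S1 S2 :
  S1 \subset two_sided i -> S2 \subset two_sided i -> S1 != set0 -> S2 != set0 ->
  {in S1 & S2, forall p q, left_before lab i p q} ->
  reachable_pages i S1 :|: reachable_pages i S2 = setT.
Proof.
move=> /subsetP sub1 /subsetP sub2 /set0Pn[p1 p1S] /set0Pn[p2 p2S] before.
apply/setP => q; rewrite in_setT in_setU; apply/negPn/negP.
rewrite negb_or => /andP[nr1 nr2].
have [_ _ [j1 ij1 lj1]] := two_sidedP (sub1 _ p1S).
have [_ [j2 j2i lj2] _] := two_sidedP (sub2 _ p2S).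
have [|x1 [b1 x1S x1_first]] := @nearest_in_set i j1 S1; first by rewrite lj1.
have [|x2 [b2 x2S x2_first]] := @nearest_in_set i j2 S2; first by rewrite lj2.
have ix1 : i <= x1 by move: b1; rewrite /between; lia.
have x2i : x2 <= i by move: b2; rewrite /between; lia.
have q_right j : lab j = q -> i <= j -> x1 <= j.
  move=> lj ij; rewrite leqNgt; apply/negP => jx1; move: (jx1).
  by rewrite (x1_first j) ?lj ?ltnn // /between; lia.
have q_left j : lab j = q -> j <= i -> j <= x2.
  move=> lj ji; rewrite leqNgt; apply/negP => x2j; move: (x2j).
  by rewrite (x2_first j) ?lj ?ltnn // /between; lia.
have lt_pos := before _ _ x1S x2S; rewrite left_beforeE in lt_pos.
have [y [yi ly ey]] := left_pos_attained (leq_ltn_trans (leq0n _) lt_pos).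
have x2y : x2 < y by have := leq_left_pos x2i; move: lt_pos; rewrite ey; lia.
have [x1M _ _] := two_sidedP (sub1 _ x1S).
have eq_q : q = lab x1.
  apply: (prec_max_between x1M) => j lj; have [ij|ji] := leqP i j.
    by exists x1 => //; have := q_right j lj ij; rewrite /between; lia.
  by exists y => //; have := q_left j lj (ltnW ji); rewrite /between; lia.
by have := q_left y; rewrite ly eq_q => /(_ erefl yi); lia.
Qed.

Definition one_sided i : {set P} := prec_max i :\: two_sided i.

Hypothesis lab_surj : forall p, exists v, lab v = p.

Lemma prec_max_eq i p q : p \in prec_max i -> q \in prec_max i ->
  (forall x y, lab x = p -> lab y = q -> between i y x || between i x y) -> p = q.
Proof.
move=> pM qM cmp; have [j lj] := lab_surj p.
have [|x [_ x_pq x_first]] := @first_hit i j (fun z => (lab z == p) || (lab z == q)).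
  by rewrite lj eqxx.
case/orP: (x_pq) => /eqP lx.
  apply/esym/(prec_max_between pM) => y ly; exists x => //.
  case/orP: (cmp x y lx ly) => // /x_first; rewrite ly eqxx orbT => /(_ isT) ->.
  by rewrite /between; lia.
apply/(prec_max_between qM) => y ly; exists x => //.
case/orP: (cmp y x ly lx) => // /x_first; rewrite ly eqxx => /(_ isT) ->.
by rewrite /between; lia.
Qed.

Lemma card_one_sided i : 1 < #|P| -> #|one_sided i| <= 2.
Proof.
move=> P_gt1; pose on_left p := [exists j : 'I_m, (j < i) && (lab j == p)].
have side p j : p \in one_sided i -> lab j = p -> if on_left p then j < i else i < j.
  move=> /setDP[pM]; rewrite in_set pM /= negb_and => not_two lj.
  have nij : (i : nat) != j.
    rewrite val_eqE; apply: contraNneq (prec_max_label_neq P_gt1 pM) => ->.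
    by rewrite lj.
  case: ifPn => [p_left|/existsPn/(_ j)]; last by rewrite lj eqxx andbT; lia.
  move: not_two; rewrite -/(on_left p) p_left /= => /existsPn/(_ j).
  by rewrite lj eqxx andbT; lia.
have on_left_inj : {in one_sided i &, injective on_left}.
  move=> p q p1 q1 eq_side; case/setDP: (p1) (q1) => pM _ /setDP[qM _].
  apply: (prec_max_eq pM qM) => x y /(side p x p1) sx /(side q y q1); move: sx; rewrite eq_side /between.
  by case: ifP; lia.
by rewrite -(card_in_imset on_left_inj) -card_bool max_card.
Qed.

End PathGeometry.

Section Phases.
Variables (P : finType) (G : ext_access_graph P) (k : nat).
Implicit Types (w : seq (vertex G)) (x : vertex G).

Definition marked w : {set P} := [set:: requests (current_phase k w)].

Definition starts_phase w x : bool := k < #|label x |: marked w|.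

Fixpoint completed_phases_from (phase w : seq (vertex G)) : nat :=
  if w is x :: w' then
    (k < size (undup (requests (rcons phase x)))) +
    completed_phases_from (phase_step k phase x) w'
  else 0.

Definition completed_phases w : nat := completed_phases_from [::] w.

Lemma set_requests_rcons w x :
  [set:: requests (rcons w x)] = label x |: [set:: requests w].
Proof. by apply/setP => p; rewrite /requests map_rcons !inE mem_rcons inE. Qed.

Lemma size_undup_requests w x :
  size (undup (requests (rcons w x))) = #|label x |: [set:: requests w]|.
Proof.
rewrite -set_requests_rcons -(card_uniqP (undup_uniq _)).
by apply: eq_card => p; rewrite inE mem_undup.
Qed.

Lemma current_phase_rcons w x : current_phase k (rcons w x) =
  if starts_phase w x then [:: x] else rcons (current_phase k w) x.
Proof. by rewrite /current_phase foldl_rcons /phase_step size_undup_requests. Qed.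

Lemma marked_rcons w x : marked (rcons w x) =
  if starts_phase w x then [set label x] else label x |: marked w.
Proof.
rewrite /marked current_phase_rcons; case: ifP => _; last exact: set_requests_rcons.
by apply/setP => p; rewrite !inE.
Qed.

Lemma completed_phases_rcons w x :
  completed_phases (rcons w x) = completed_phases w + starts_phase w x.
Proof.
rewrite /starts_phase /marked -size_undup_requests /completed_phases /current_phase.
by elim: w [::] => [|y w IH] phase /=; rewrite ?addn0 // IH addnA.
Qed.

Lemma current_phase_id w : completed_phases w = 0 -> current_phase k w = w.
Proof.
elim/last_ind: w => // w x IH; rewrite completed_phases_rcons current_phase_rcons.
by case: starts_phase; rewrite ?addn1 // addn0 => /IH ->.
Qed.

Lemma current_phase_suffix w : exists w0, w = w0 ++ current_phase k w.
Proof.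
elim/last_ind: w => [|w x [w0 ew]]; first by exists [::].
rewrite current_phase_rcons; case: ifP => _; first by exists w; rewrite cats1.
by exists w0; rewrite -rcons_cat -ew.
Qed.

Lemma current_phase_walk w x : is_walk (rcons w x) -> exists i s,
  [/\ current_phase k (rcons w x) = i :: s, is_walk (i :: s) & last i s = x].
Proof.
have [w0 ew] := current_phase_suffix (rcons w x); rewrite {1}ew => /is_walk_catr.
rewrite current_phase_rcons; case: ifP => _; first by exists x, [::].
case: (current_phase k w) => [|i s] ws; first by exists x, [::].
by exists i, (rcons s x); rewrite last_rcons.
Qed.

Lemma starts_phase_notin_marked w x :
  #|marked w| <= k -> starts_phase w x -> label x \notin marked w.
Proof. by rewrite /starts_phase cardsU1; case: (_ \in _) => //=; lia. Qed.

Hypothesis k_gt0 : 0 < k.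

Lemma card_marked w : #|marked w| <= k.
Proof.
elim/last_ind: w => [|w x IH].
  by rewrite /marked set_nil cards0.
by rewrite marked_rcons; case: ifP; rewrite ?cards1 // /starts_phase ltnNge => /negbFE.
Qed.

(* Within a phase, the union of the marked pages and the cache grows by at most  *)
(* one page per fault; when the next phase starts, it would exceed k pages, and  *)
(* it then shrinks back to the cache.                                            *)
Lemma completed_phases_le_nfaults w (s : seq (P * P)) :
  unzip1 s = requests w -> valid_service k set0 s ->
  completed_phases w + #|marked w :|: cache_after k set0 s| <= nfaults k set0 s /\
  (0 < completed_phases w -> completed_phases w + k <= nfaults k set0 s).
Proof.
elim/last_ind: w s => [|w x IH] s es vs.
  by case: s es vs => // _ _; rewrite /marked set_nil set0U cards0.
case/lastP: s es vs => [|s pe].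
  by move/(congr1 size); rewrite !size_map size_rcons.
rewrite /unzip1 map_rcons /requests map_rcons => /rcons_inj[es ex].
rewrite -cats1 valid_service_cat /= andbT => /andP[vs e_ok]; rewrite cats1.
have {IH} [le_union le_k] := IH s es vs.
rewrite nfaults_rcons cache_after_rcons completed_phases_rcons marked_rcons -ex.
rewrite /starts_phase -ex; set Q := marked w in le_union *.
set C := cache_after _ _ _ in e_ok le_union *.
have union_step : #|pe.1 |: (Q :|: C)| <= #|Q :|: C| + (pe.1 \notin C).
  by rewrite cardsU1 in_setU addnC leq_add2l; case: (pe.1 \in C); rewrite ?orbT ?leq_b1.
have card_union_le (S : {set P}) :
    S \subset pe.1 |: (Q :|: C) -> #|S| <= #|Q :|: C| + (pe.1 \notin C).
  by move=> sub; apply: leq_trans union_step; apply: subset_leq_card.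
case: ltnP => Qk; last first.
  rewrite addn0; split; last by move/le_k; lia.
  suff /card_union_le : pe.1 |: Q :|: serve k C pe \subset pe.1 |: (Q :|: C) by lia.
  rewrite subUset setUS ?subsetUl //=; apply: subset_trans (serve_subset _ _ _) _.
  by rewrite setUS ?subsetUr.
have {}Qk : k < #|Q :|: C| + (pe.1 \notin C).
  by apply: leq_trans Qk (card_union_le _ _); rewrite setUS ?subsetUl.
have serve_le : #|[set pe.1] :|: serve k C pe| <= k.
  by rewrite (setUidPr _) ?sub1set ?mem_serve ?card_serve ?card_cache_after ?cards0.
by split=> [|_]; lia.
Qed.

Lemma completed_phases_le_OPT w :
  completed_phases w + (if completed_phases w == 0 then #|marked w| else k) <=
  OPT k (requests w).
Proof.
apply: OPT_ge => // s es vs; have [le_union le_k] := completed_phases_le_nfaults es vs.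
have [c0|c_gt0] := posnP (completed_phases w); last exact: le_k.
apply: leq_trans le_union; rewrite leq_add2l; exact/subset_leq_card/subsetUl.
Qed.

Lemma alg_first_phase (A : online_alg G) w : completed_phases w = 0 ->
  alg_cache k A w = marked w /\ alg_faults k A w = #|marked w|.
Proof.
move=> c0; have markedE : marked w = set0 :|: [set:: unzip1 (service A w)].
  by rewrite set0U unzip1_service /marked current_phase_id.
have [|_ cs fs] := @service_no_eviction P k set0 (service A w).
  by rewrite -markedE card_marked.
by rewrite /alg_cache /alg_faults cs markedE -fs cards0 addn0.
Qed.

End Phases.

Section Potential.
Variables (P : finType) (m : nat) (lab : 'I_m -> P).
Local Notation G := (path_graph lab).
Local Notation two_sided := (prec_max_two_sided lab).
Local Notation one_sided := (@one_sided P m lab).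
Implicit Types (i : vertex G) (Q : {set P}) (h : P).

(* A bound on the faults still to come in a phase begun at i, just before an     *)
(* eviction made when the pages of Q are marked; [hole_potential] is the bound   *)
(* once h has been evicted.                                                      *)
Definition unmarked_potential i Q : nat :=
  up_log 2 #|two_sided i :\: Q|.+1 + #|one_sided i :\: Q|.

Definition unmarked_before i Q h : {set P} :=
  [set q in two_sided i :\: Q | left_before lab i q h].

Definition unmarked_after i Q h : {set P} :=
  [set q in two_sided i :\: Q | left_before lab i h q].

Definition hole_potential i Q h : nat :=
  up_log 2 (maxn #|unmarked_before i Q h| #|unmarked_after i Q h|).+1 +
  (h \in two_sided i) + #|one_sided i :\: Q|.

Definition maximal_hole i Q h : bool :=
  (h \in prec_max i :\: Q) && ((h \in two_sided i) || (two_sided i \subset Q)).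

Lemma in_unmarked_before i Q h q : (q \in unmarked_before i Q h) =
  (q \in two_sided i :\: Q) && (left_pos i h < left_pos i q).
Proof. by rewrite in_set left_beforeE. Qed.

Lemma in_unmarked_after i Q h q : (q \in unmarked_after i Q h) =
  (q \in two_sided i :\: Q) && (left_pos i q < left_pos i h).
Proof. by rewrite in_set left_beforeE. Qed.

Lemma unmarked_before_subset i Q h : unmarked_before i Q h \subset two_sided i :\: Q.
Proof. by rewrite /unmarked_before setIdE subsetIl. Qed.

Lemma unmarked_after_subset i Q h : unmarked_after i Q h \subset two_sided i :\: Q.
Proof. by rewrite /unmarked_after setIdE subsetIl. Qed.

Lemma card_unmarked_before_after i Q h : h \in two_sided i :\: Q ->
  #|unmarked_before i Q h| + #|unmarked_after i Q h| < #|two_sided i :\: Q|.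
Proof.
move=> hS; set S := _ :\: _ in hS *.
have disj : [disjoint unmarked_before i Q h & unmarked_after i Q h].
  rewrite -setI_eq0; apply/eqP/setP => q.
  rewrite in_setI in_unmarked_before in_unmarked_after in_set0.
  by case: ltngtP; rewrite ?andbF.
rewrite -cardsUI (disjoint_setI0 disj) cards0 addn0; apply/proper_card/properP; split.
  by rewrite subUset unmarked_before_subset unmarked_after_subset.
by exists h; rewrite // in_setU in_unmarked_before in_unmarked_after ltnn !andbF.
Qed.

Lemma setD_prec_max_two_sided i Q :
  (prec_max i :\: Q) :&: two_sided i = two_sided i :\: Q.
Proof. by rewrite setIDAC (setIidPr (two_sided_subset _)). Qed.

Lemma maxfar_choice_maximal_hole i Q h :
  maxfar_choice lab i (prec_max i :\: Q) h -> maximal_hole i Q h.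
Proof.
rewrite /maxfar_choice /maximal_hole setD_prec_max_two_sided.
case: ifP => [/eqP S0 -> /=|_ /and3P[/setDP[hS hQ] _ _]].
  by rewrite orbC -setD_eq0 S0 eqxx.
by rewrite in_setD hQ hS (subsetP (two_sided_subset _) h hS).
Qed.

Lemma hole_potential_maxfar i Q h : maxfar_choice lab i (prec_max i :\: Q) h ->
  hole_potential i Q h <= unmarked_potential i Q.
Proof.
rewrite /maxfar_choice setD_prec_max_two_sided /hole_potential /unmarked_potential.
rewrite leq_add2r; case: ifP => [/eqP S0 /setDP[_ hQ]|_].
  have -> : h \in two_sided i = false.
    by apply: contraFF (in_set0 h) => hS; rewrite -S0 in_setD hQ.
  rewrite addn0; apply: leq_up_log; rewrite ltnS geq_max.
  by rewrite !subset_leq_card ?unmarked_before_subset ?unmarked_after_subset.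
rewrite /in_middle -/(unmarked_before i Q h) -/(unmarked_after i Q h).
move=> /and3P[hS before_le after_le]; have sum_lt := card_unmarked_before_after hS.
have -> : h \in two_sided i by case/setDP: hS.
rewrite [leqRHS]up_log2S; last by lia.
by rewrite addn1 ltnS leq_up_log // ltnS; lia.
Qed.

Lemma hole_potential_mark i Q Q' h :
  Q \subset Q' -> hole_potential i Q' h <= hole_potential i Q h.
Proof.
move=> QQ'; rewrite /hole_potential; apply: leq_add; last first.
  by rewrite subset_leq_card // setDS.
have mono (f : pred P) :
    #|[set q in two_sided i :\: Q' | f q]| <= #|[set q in two_sided i :\: Q | f q]|.
  by apply: subset_leq_card; rewrite !setIdE setSI ?setDS.
rewrite leq_add2r leq_up_log // ltnS geq_max !leq_max.
by rewrite (mono (left_before lab i ^~ h)) (mono (left_before lab i h)) orbT.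
Qed.

Lemma unmarked_potential_fault i Q Q' h :
  maximal_hole i Q h -> Q \subset Q' -> h \in Q' ->
  (forall q, left_before lab i q h -> q \in Q') \/
  (forall q, left_before lab i h q -> q \in Q') ->
  unmarked_potential i Q' < hole_potential i Q h.
Proof.
move=> /andP[/setDP[hM hQ] hole_max] QQ' hQ' side_visited.
have sub S : S :\: Q' \subset S :\: Q by apply: setDS.
rewrite /unmarked_potential /hole_potential.
have [hS|h_one] := boolP (h \in two_sided i).
  rewrite addn1 addSn ltnS leq_add ?subset_leq_card ?sub //.
  rewrite leq_up_log // ltnS leq_max.
  have distinct q : q \in two_sided i :\: Q' -> left_pos i q != left_pos i h.
    by case/setDP => q_two; apply: contraNneq => /(two_sided_left_pos_inj q_two hS) ->.
  apply/orP; case: side_visited => visited; [right|left];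
    apply/subset_leq_card/subsetP => q qS.
    rewrite in_unmarked_after (subsetP (sub _) q qS) ltn_neqAle distinct //= leqNgt.
    by rewrite -left_beforeE; case/setDP: qS => _; apply: contra => /visited.
  rewrite in_unmarked_before (subsetP (sub _) q qS) ltn_neqAle eq_sym distinct //= leqNgt.
  by rewrite -left_beforeE; case/setDP: qS => _; apply: contra => /visited.
rewrite (negbTE h_one) /= in hole_max.
have /eqP -> : two_sided i :\: Q' == set0.
  by rewrite setD_eq0; apply: subset_trans QQ'.
rewrite cards0 up_log1 add0n addn0 ltn_addl // proper_card //.
by apply/properP; split=> //; exists h; rewrite !in_setD ?hQ' ?hQ ?h_one ?hM.
Qed.

Lemma unmarked_potential_le i Q L : (forall p, exists v, lab v = p) -> 1 < #|P| ->
  #|two_sided i| < 2 ^ L -> unmarked_potential i Q <= L + 2.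
Proof.
move=> lab_surj P_gt1 small; apply: leq_add.
  apply: up_log_min => //; apply: leq_ltn_trans small.
  by rewrite subset_leq_card ?subsetDl.
by apply: leq_trans (card_one_sided lab_surj i P_gt1); rewrite subset_leq_card ?subsetDl.
Qed.

End Potential.

Section MaxfarUpperBound.
Variables (P : finType) (m k : nat) (lab : 'I_m -> P).
Local Notation G := (path_graph lab).
Variables (A : online_alg G) (L : nat).
Hypothesis k_gt0 : 0 < k.
Hypothesis P_card : #|P| = k.+1.
Hypothesis lab_surj : forall p, exists v, lab v = p.
Hypothesis A_maxfar : is_maxfar k A.
Hypothesis two_sided_small : forall i, #|prec_max_two_sided lab i| < 2 ^ L.
Implicit Types (w s : seq (vertex G)) (i x : vertex G) (h : P).

Lemma maxfar_evicts w x i s :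
  is_walk (rcons w x) -> lab x \notin alg_cache k A w -> k <= #|alg_cache k A w| ->
  current_phase k (rcons w x) = i :: s ->
  maxfar_choice lab i (prec_max i :\: marked k (rcons w x)) (A (rcons w x)).
Proof.
move=> ww xC Ck cp; have [_ /(_ w x ww xC Ck)] := A_maxfar; rewrite cp /=.
congr (is_true (maxfar_choice lab i _ _)); apply/setP => p.
by rewrite in_setD in_set /marked cp inE andbC.
Qed.

Lemma lab_in_marked_rcons w x : lab x \in marked k (rcons w x).
Proof. by rewrite marked_rcons; case: ifP; rewrite ?set11 ?setU11. Qed.

Definition maxfar_state w i h : Prop :=
  [/\ exists s, current_phase k w = i :: s, alg_cache k A w = [set~ h],
      maximal_hole i (marked k w) h &
      alg_faults k A w + hole_potential i (marked k w) h <=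
        k + (L + 3) * completed_phases k w].

Lemma maxfar_state_fault w x i s :
  is_walk (rcons w x) -> lab x \notin alg_cache k A w -> k <= #|alg_cache k A w| ->
  current_phase k (rcons w x) = i :: s ->
  alg_faults k A w + unmarked_potential i (marked k (rcons w x)) <
    k + (L + 3) * completed_phases k (rcons w x) ->
  maxfar_state (rcons w x) i (A (rcons w x)).
Proof.
move=> ww xC Ck cp potential_le; have choice := maxfar_evicts ww xC Ck cp.
have hole := maxfar_choice_maximal_hole choice.
split=> //; first by exists s.
  rewrite alg_cache_rcons (full_cache_hole P_card xC Ck) serve_hole //.
  case/andP: hole => /setDP[_ unmarked] _; apply: contraNneq unmarked => <-.
  exact: lab_in_marked_rcons.
rewrite alg_faults_rcons xC addn1; apply: leq_trans potential_le.
by rewrite addSn ltnS leq_add2l hole_potential_maxfar.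
Qed.

Lemma maxfar_state_new_phase w x : is_walk (rcons w x) -> starts_phase k w x ->
  completed_phases k w = 0 \/ (exists i h, maxfar_state w i h) ->
  exists i h, maxfar_state (rcons w x) i h.
Proof.
move=> ww new prev; have x_marked := starts_phase_notin_marked (card_marked k_gt0 w) new.
have [xC Ck faults_le] : [/\ lab x \notin alg_cache k A w, k <= #|alg_cache k A w| &
    alg_faults k A w <= k + (L + 3) * completed_phases k w].
  case: prev => [c0|[i [h [_ ca /andP[/setDP[_ h_marked] _] faults_le]]]].
    have [-> ->] := alg_first_phase k_gt0 A c0; have := card_marked k_gt0 w.
    by split=> //; [move: new; rewrite /starts_phase cardsU1; lia | lia].
  rewrite ca (card_setC1_cache P_card) in_setC1 negbK; split=> //; last by lia.
  apply: contraLR new => xh; rewrite /starts_phase -leqNgt.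
  suff /subset_leq_card : lab x |: marked k w \subset [set~ h].
    by rewrite (card_setC1_cache P_card).
  rewrite subUset sub1set in_setC1 xh /=.
  by apply/subsetP => p p_marked; rewrite in_setC1; apply: contraNneq h_marked => <-.
have [i [s [cp _ _]]] := current_phase_walk k ww.
exists i, (A (rcons w x)); apply: (maxfar_state_fault ww xC Ck cp).
have P_gt1 : 1 < #|P| by rewrite P_card ltnS.
have := unmarked_potential_le (marked k (rcons w x)) lab_surj P_gt1 (two_sided_small i).
by rewrite completed_phases_rcons new mulnDr muln1; lia.
Qed.

Lemma maxfar_state_same_phase w x i h : is_walk (rcons w x) -> ~~ starts_phase k w x ->
  maxfar_state w i h -> exists h', maxfar_state (rcons w x) i h'.
Proof.
move=> ww same [[s0 cp0] ca hole faults_le].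
have mE := marked_rcons k w x; rewrite (negbTE same) in mE.
have cE : completed_phases k (rcons w x) = completed_phases k w.
  by rewrite completed_phases_rcons (negbTE same) addn0.
have cp : current_phase k (rcons w x) = i :: rcons s0 x.
  by rewrite current_phase_rcons (negbTE same) cp0.
have marked_sub : marked k w \subset marked k (rcons w x) by rewrite mE subsetUr.
have [xh|xh] := eqVneq (lab x) h; last first.
  have xC : label x \in alg_cache k A w by rewrite ca in_setC1.
  exists h; split; first by exists (rcons s0 x).
  - by rewrite alg_cache_rcons serve_hit.
  - case/andP: hole => /setDP[hM h_marked] h_two; rewrite /maximal_hole in_setD hM.
    rewrite mE in_setU1 negb_or eq_sym xh h_marked /=.
    case/orP: h_two => [->//|two_marked]; apply/orP; right.
    exact: subset_trans two_marked (subsetUr _ _).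
  rewrite alg_faults_rcons xC addn0 cE; apply: leq_trans faults_le.
  by rewrite leq_add2l hole_potential_mark.
have xC : lab x \notin alg_cache k A w by rewrite ca in_setC1 xh negbK.
have Ck : k <= #|alg_cache k A w| by rewrite ca (card_setC1_cache P_card).
exists (A (rcons w x)); apply: (maxfar_state_fault ww xC Ck cp).
rewrite cE; apply: leq_trans faults_le; rewrite ltn_add2l.
apply: (unmarked_potential_fault hole marked_sub).
  by rewrite -xh lab_in_marked_rcons.
have [i' [s [cp' ws ls]]] := current_phase_walk k ww; move: cp'; rewrite cp => -[ei es].
have hM : lab (last i (rcons s0 x)) \in prec_max i.
  by rewrite last_rcons xh; case/andP: hole => /setDP[].
rewrite -ei -es in ws; have := visited_left_or_right ws hM; rewrite last_rcons xh.
by case=> visited; [left|right] => q /visited; rewrite /marked cp inE.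
Qed.

Lemma maxfar_invariant w : is_walk w -> 0 < completed_phases k w ->
  exists i h, maxfar_state w i h.
Proof.
elim/last_ind: w => // w x IH wx.
have {}IH : completed_phases k w = 0 \/ exists i h, maxfar_state w i h.
  have [->|c_gt0] := posnP (completed_phases k w); first by left.
  by right; apply: IH c_gt0; move: wx; rewrite -cats1 => /is_walk_catl.
have [new _|same] := boolP (starts_phase k w x); first exact: maxfar_state_new_phase.
rewrite completed_phases_rcons (negbTE same) addn0 => c_gt0.
case: IH => [c0|[i [h state]]]; first by rewrite c0 in c_gt0.
by exists i; apply: maxfar_state_same_phase state.
Qed.

Lemma maxfar_faults_le_OPT w : is_walk w ->
  alg_faults k A w <= (L + 3) * OPT k (requests w).
Proof.
move=> ww; have := completed_phases_le_OPT k_gt0 w.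
have [c0|c_gt0] := posnP (completed_phases k w).
  have [_ ->] := alg_first_phase k_gt0 A c0; rewrite c0 => /leq_trans; apply.
  by rewrite leq_pmull // addnS.
have [i [h [_ _ _ faults_le]]] := maxfar_invariant ww c_gt0.
have le_faults : alg_faults k A w <= (L + 3) * (completed_phases k w + k).
  by apply: leq_trans (leq_addr _ _) (leq_trans faults_le _); rewrite mulnDr mulnDl; lia.
by move=> le_OPT; apply: leq_trans le_faults _; rewrite leq_mul2l le_OPT orbT.
Qed.

End MaxfarUpperBound.

Local Open Scope ring_scope.

Section ExpectedFaults.
Variables (R : realType) (P : finType) (G : ext_access_graph P) (k : nat).
Variable A : rand_alg G k R.
Implicit Types (w u : seq (vertex G)).
Local Notation run := (@rand_run _ _ _ _ A).
Local Notation Omega := (rand_space A).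
Local Notation faults w := (fun omega : Omega => (alg_faults k (run omega) w)%:R : R).

(* The number of faults depends only on the finitely many evictions along w.     *)
Lemma measurable_faults w : measurable_fun classical_sets.setT (faults w).
Proof.
move=> _ Y mY; rewrite classical_sets.setTI.
pose evictions omega := [tuple run omega (take j.+1 w) | j < size w].
pose faults_of (t : (size w).-tuple P) : R := (nfaults k set0 (zip (requests w) t))%:R.
have faultsE omega : faults w omega = faults_of (evictions omega).
  by rewrite /alg_faults /service -val_enum_ord -map_comp.
rewrite (_ : _ @^-1` _ = \bigcup_(t in [set t | Y (faults_of t)])
    \bigcap_(j in [set: 'I_(size w)])
      [set omega | run omega (take j.+1 w) = tnth t j])%classic.
  apply: fin_bigcup_measurable => [|t _]; first exact: finite_finset.
  by apply: fin_bigcap_measurable => [|j _]; [exact: finite_finset|exact: rand_meas].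
apply/seteqP; split=> omega /=.
  by rewrite faultsE => Yf; exists (evictions omega) => // j _; rewrite /= tnth_mktuple.
move=> [t Yt ev]; rewrite faultsE (_ : evictions omega = t) //.
by apply: eq_from_tnth => j; rewrite tnth_mktuple; apply: ev.
Qed.

Let measurable_EFin_faults w :
  measurable_fun classical_sets.setT (fun omega : Omega => (faults w omega)%:E : \bar R).
Proof. exact/measurable_EFinP/measurable_faults. Qed.

Definition exp_faults w : R := fine (rand_faults A w).

Let rand_faults_integral w :
  rand_faults A w = (\int[rand_prob A]_omega (faults w omega)%:E)%E.
Proof. by rewrite /rand_faults unlock. Qed.

Let integral_cst_prob (r : R) : (\int[rand_prob A]_omega r%:E)%E = r%:E.
Proof. by have := expectation_cst (rand_prob A) r; rewrite unlock. Qed.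

Lemma exp_faultsE w : rand_faults A w = (exp_faults w)%:E.
Proof.
rewrite /exp_faults fineK // ge0_fin_numE; last first.
  by apply: expectation_ge0 => omega; apply: ler0n.
apply: le_lt_trans (ltry (size w)%:R).
rewrite -(integral_cst_prob (size w)%:R) rand_faults_integral.
apply: ge0_le_integral => // omega _; rewrite lee_fin ?ler0n // ler_nat.
exact: alg_faults_le_size.
Qed.

Lemma exp_faults_ge (n : nat) w : (forall omega, (n <= alg_faults k (run omega) w)%N) ->
  n%:R <= exp_faults w.
Proof.
move=> n_le; rewrite -lee_fin -exp_faultsE rand_faults_integral.
rewrite -(integral_cst_prob n%:R).
by apply: ge0_le_integral => // omega _; rewrite lee_fin ?ler0n // ler_nat.
Qed.

Lemma ler_exp_faults_cat w u : exp_faults w <= exp_faults (w ++ u).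
Proof.
rewrite -lee_fin -!exp_faultsE !rand_faults_integral.
apply: ge0_le_integral => // omega _; rewrite lee_fin ?ler0n // ler_nat.
exact: leq_alg_faults_cat.
Qed.

Lemma exp_faults_covering_pair w u1 u2 : (k < #|P|)%N -> is_walk w ->
  (forall p, (p \in requests u1) || (p \in requests u2)) ->
  exp_faults w *+ 2 + 1 <= exp_faults (w ++ u1) + exp_faults (w ++ u2).
Proof.
move=> kP ww cov; rewrite mulr2n -lee_fin !EFinD -!exp_faultsE !rand_faults_integral.
have faults_ge0 v (omega : Omega) :
    classical_sets.setT omega -> (0 <= (faults v omega)%:E)%E by rewrite lee_fin ler0n.
rewrite -(integral_cst_prob 1) -!ge0_integralD //; last 2 first.
- by move=> omega _; rewrite adde_ge0 // lee_fin ler0n.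
- exact: emeasurable_funD.
apply: ge0_le_integral => //.
- by move=> omega _; rewrite -!EFinD lee_fin !addr_ge0 ?ler0n.
- by do 2?apply: emeasurable_funD.
- exact: emeasurable_funD.
move=> omega _; rewrite -!EFinD lee_fin -!natrD -[1]/(1%:R) -natrD ler_nat.
by rewrite addnn addn1; apply: alg_faults_covering_pair => //; apply: rand_valid.
Qed.

End ExpectedFaults.

Section Adversary.
Variables (R : realType) (P : finType) (m k : nat) (lab : 'I_m -> P).
Local Notation G := (path_graph lab).
Local Notation two_sided := (prec_max_two_sided lab).
Variable A : rand_alg G k R.
Local Notation E := (exp_faults A).
Hypothesis P_card : #|P| = k.+1.
Implicit Types (i : vertex G) (u v : seq (vertex G)) (p q : P) (S : {set P}).

Lemma adversary_step i v S n :
  closed_walk i v -> S \subset two_sided i -> (0 < n)%N -> (n.*2 <= #|S|)%N ->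
  exists u S', [/\ closed_walk i u, S' \subset S, (n <= #|S'|)%N,
    {in requests u, forall p, p \notin S'} & E (i :: v) + 1 / 2 <= E (i :: v ++ u)].
Proof.
move=> wv S_two n_gt0 nS.
have S_inj : {in S &, injective (left_pos i)}.
  by move=> p q /(subsetP S_two) pS /(subsetP S_two); apply: two_sided_left_pos_inj.
have [S1 [S2 [[sub1 sub2] n1 n2 lt_pos]]] := exists_separated_halves S_inj nS.
have [u1 wu1 u1E] := exists_tour i S1; have [u2 wu2 u2E] := exists_tour i S2.
have nonempty S' : (n <= #|S'|)%N -> S' != set0 by rewrite -card_gt0; apply: leq_trans.
have gain : E (i :: v) *+ 2 + 1 <= E (i :: v ++ u1) + E (i :: v ++ u2).
  apply: (@exp_faults_covering_pair R P G k A (i :: v)).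
  - by rewrite P_card.
  - exact: closed_walk_is_walk.
  move=> q; rewrite u1E u2E -in_setU setUC reachable_pages_separated ?in_setT ?nonempty //.
  - exact: subset_trans S_two.
  - exact: subset_trans S_two.
  - by move=> p p' pS2 pS1; rewrite left_beforeE lt_pos.
have [half1|lt_half1] := lerP (E (i :: v) + 1 / 2) (E (i :: v ++ u1)).
  by exists u1, S1; split=> // p; rewrite u1E => /reachable_pages_notin.
exists u2, S2; split=> //; first by move=> p; rewrite u2E => /reachable_pages_notin.
lra.
Qed.

Lemma adversary_round i d v S :
  closed_walk i v -> S \subset two_sided i -> (2 ^ d <= #|S|)%N ->
  exists u p, [/\ closed_walk i u, p \in S, requests u =i predC1 p &
    E (i :: v) + d%:R / 2 <= E (i :: v ++ u)].
Proof.
elim: d v S => [|d IH] v S wv S_two S_large.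
  have /card_gt0P[p pS] := S_large; have [pM _ _] := two_sidedP (subsetP S_two p pS).
  have [u wu uE] := exists_tour_missing pM.
  by exists u, p; split; rewrite // mul0r addr0 -cat_cons ler_exp_faults_cat.
have [||u1 [S' [wu1 S'S S'_large u1S' half]]] := @adversary_step i v S (2 ^ d) wv S_two.
- by rewrite expn_gt0.
- by rewrite -mul2n -expnS.
have [u2 [p [wu2 pS' u2E round]]] :=
  IH (v ++ u1) S' (closed_walk_cat wv wu1) (subset_trans S'S S_two) S'_large.
exists (u1 ++ u2), p; split; first exact: closed_walk_cat.
- exact: (subsetP S'S).
- move=> q; rewrite /requests map_cat mem_cat u2E !inE.
  by case: eqVneq => [->|]; rewrite ?orbT // orbF; apply/negP => /u1S'; rewrite pS'.
by rewrite catA; apply: le_trans round; rewrite -natr1; lra.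
Qed.

Lemma adversary_rounds i d n : (1 < #|P|)%N -> (2 ^ d <= #|two_sided i|)%N ->
  exists v q, [/\ closed_walk i v, servable k (requests (i :: v)) [set~ q] (n + k) &
    n%:R * (d%:R / 2) <= E (i :: v)].
Proof.
move=> P_gt1 large; elim: n => [|n [v [q [wv served En]]]].
  have /card_gt0P[p /two_sidedP[pM _ _]] : (0 < #|two_sided i|)%N.
    by apply: leq_trans large; rewrite expn_gt0.
  have [u wu uE] := exists_tour_missing pM; exists u, p; split=> //.
    apply: servable_missing => // q; rewrite inE uE !inE orb_idl // => /eqP ->.
    exact: prec_max_label_neq.
  by rewrite mul0r (@exp_faults_ge _ _ _ _ A 0).
have [u [p [wu _ uE round]]] := adversary_round wv (subxx _) large.
exists (v ++ u), p; split; first exact: closed_walk_cat.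
  by rewrite -cat_cons /requests map_cat; apply: servable_cat_missing served uE.
by apply: le_trans round; rewrite -natr1; lra.
Qed.

End Adversary.

Lemma natmul_bounded_le0 (R : archiRealFieldType) (a c : R) :
  (forall n : nat, n%:R * a <= c) -> a <= 0.
Proof.
move=> bounded; rewrite leNgt; apply/negP => a_gt0.
have := bounded (Num.Def.archi_bound `|c / a|); rewrite leNgt => /negP; apply.
by rewrite -ltr_pdivrMr // (le_lt_trans (ler_norm _)) // archi_boundP.
Qed.

Section AsymptoticRatio.
Variables (R : realType) (P : finType) (G : ext_access_graph P) (k : nat).
Implicit Types (A : rand_alg G k R) (r C a : R).

Definition asymptotic_bound A r C : Prop := forall w, is_walk w ->
  exp_faults A w <= r * (OPT k (requests w))%:R + C.

Definition unbounded_OPT : Prop := forall n,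
  exists2 w : seq (vertex G), is_walk w & (n <= OPT k (requests w))%N.

Lemma r_obl_infty_ge a :
  (forall A r C, asymptotic_bound A r C -> a <= r) -> (a%:E <= r_obl_infty G k R)%E.
Proof.
move=> a_le; apply/ereal_infP => _ [A ->]; apply/ereal_infP => _ [r [C [_ bound]] <-].
rewrite lee_fin; apply: (a_le A r C) => w /bound.
by rewrite exp_faultsE lee_fin.
Qed.

Lemma asymptotic_bound_ge1 A r C : unbounded_OPT -> asymptotic_bound A r C -> 1 <= r.
Proof.
move=> OPT_unbounded bound; rewrite -subr_le0.
apply: (@natmul_bounded_le0 _ _ `|C|) => n; have [w ww nO] := OPT_unbounded n.
have OPT_le : (OPT k (requests w))%:R <= exp_faults A w.
  by apply: exp_faults_ge => omega; apply: OPT_le_alg_faults => //; apply: rand_valid.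
have OPT_bounded : (OPT k (requests w))%:R * (1 - r) <= `|C|.
  by have := le_trans OPT_le (bound w ww); have := ler_norm C; lra.
have [r1|r1] := lerP (1 - r) 0; first by rewrite (le_trans (mulr_ge0_le0 _ r1)).
by apply: le_trans OPT_bounded; rewrite ler_pM2r // ler_nat.
Qed.

End AsymptoticRatio.

Section PathRatio.
Variables (R : realType) (P : finType) (m k : nat) (lab : 'I_m -> P).
Local Notation G := (path_graph lab).
Hypothesis k_gt0 : (0 < k)%N.
Hypothesis P_card : #|P| = k.+1.
Hypothesis lab_surj : forall p, exists v, lab v = p.

Let P_gt1 : (1 < #|P|)%N. Proof. by rewrite P_card ltnS. Qed.

Lemma card_vertices_gt0 : (0 < #|vertex G|)%N.
Proof.
have /card_gt0P[p _] : (0 < #|P|)%N by rewrite P_card.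
by have [i _] := lab_surj p; apply/card_gt0P; exists i.
Qed.

Lemma path_unbounded_OPT : unbounded_OPT G k.
Proof.
have /card_gt0P[i _] := card_vertices_gt0.
suff closed n : exists2 u, closed_walk i u & (n <= OPT k (requests (i :: u)))%N.
  by move=> n; have [u /closed_walk_is_walk wu nO] := closed n; exists (i :: u).
elim: n => [|n [u wu nO]]; first by exists [::]; rewrite /closed_walk /= ?eqxx.
have [t wt tE] := @exists_tour P m lab i set0.
exists (u ++ t); first exact: closed_walk_cat.
rewrite -cat_cons /requests map_cat; apply: leq_ltn_trans nO _.
apply: OPT_lt_cat_cover => [//||p]; first by rewrite P_card.
by rewrite tE reachable_pages0 ?inE.
Qed.

Lemma r_obl_infty_ge1 : (1%:E <= r_obl_infty G k R)%E.
Proof.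
by apply: r_obl_infty_ge => A r C; apply: asymptotic_bound_ge1; apply: path_unbounded_OPT.
Qed.

Definition max_two_sided : nat := \max_(i : vertex G) #|prec_max_two_sided lab i|.

Lemma r_obl_infty_ge_half_log :
  (((trunc_log 2 max_two_sided)%:R / 2 : R)%:E <= r_obl_infty G k R)%E.
Proof.
have [max0|max_gt0] := posnP max_two_sided.
  by rewrite max0 mul0r; apply: le_trans r_obl_infty_ge1; rewrite lee_fin.
have [i max_i] :=
  bigop.eq_bigmax (fun i : vertex G => #|prec_max_two_sided lab i|) card_vertices_gt0.
have large := trunc_logP (isT : 1 < 2)%N max_gt0; rewrite {2}/max_two_sided max_i in large.
apply: r_obl_infty_ge => A r C bound.
have r_ge0 : 0 <= r by apply: le_trans (asymptotic_bound_ge1 path_unbounded_OPT bound).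
rewrite -subr_le0; apply: (@natmul_bounded_le0 _ _ (r * k%:R + C)) => n.
have [v [q [wv /servable_OPT OPT_le En]]] := adversary_rounds A P_card n P_gt1 large.
have := le_trans En (bound _ (closed_walk_is_walk wv)).
have : r * (OPT k (requests (i :: v)))%:R <= r * (n%:R + k%:R).
  by rewrite ler_wpM2l // -natrD ler_nat.
lra.
Qed.

Lemma r_det_maxfar_le (A : online_alg G) : is_maxfar k A ->
  (r_det k R A <= (trunc_log 2 max_two_sided + 4)%:R%:E)%E.
Proof.
move=> A_maxfar; apply: ereal_inf_lbound.
exists (trunc_log 2 max_two_sided + 4)%:R => // w ww.
rewrite lee_fin -natrM ler_nat addnS -addSn.
apply: (maxfar_faults_le_OPT k_gt0 P_card lab_surj A_maxfar) => // i.
by apply: leq_ltn_trans (trunc_log_ltn _ _) => //; apply: leq_bigmax.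
Qed.

End PathRatio.

Theorem mainTheorem5 (R : realType) :
  exists b : R, 0 < b /\
    forall (k : nat) (P : finType) (m : nat) (lab : 'I_m -> P)
           (A : online_alg (path_graph lab)),
      (1 <= k)%N ->
      #|P| = k.+1 ->
      (forall p : P, exists v : 'I_m, lab v = p) ->
      is_maxfar k A ->
      (r_det k R A <= b%:E * r_obl_infty (path_graph lab) k R)%E.
Proof.
exists 6; split=> // k P m lab A k_gt0 P_card lab_surj A_maxfar.
pose d := trunc_log 2 (max_two_sided lab).
have upper : (r_det k R A <= (d + 4)%:R%:E)%E by apply: r_det_maxfar_le.
have lower : ((Num.max 1 (d%:R / 2) : R)%:E <= r_obl_infty (path_graph lab) k R)%E.
  by rewrite EFin_max ge_max r_obl_infty_ge1 // r_obl_infty_ge_half_log.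
apply: le_trans upper _; apply: le_trans (lee_wpmul2l _ lower); last by rewrite lee_fin.
by rewrite -EFinM lee_fin natrD; case: (lerP 1 (d%:R / 2)); lra.
Qed.
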